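(* Let $q$ be a prime power, $n\ge 2$, $E=\mathbb{F}_q^n$, and $1\le k\le n-1$. Let $\mathcal{S}_1,\mathcal{S}_2$ be collections of $k$-dimensional subspaces of $E$ such that, for $i=1,2$, $\dim(V\cap W)\le k-2$ for all distinct $V,W\in\mathcal{S}_i$, and assume $\mathcal{S}_1\cap\mathcal{S}_2=\emptyset$. Let $\mathcal{M}_i$ be the paving $q$-matroid induced by $\mathcal{S}_i$ ($i=1,2$), let $\lambda\in\mathbb{Q}$ with $0<\lambda<1$, let $\mathcal{M}=\lambda\mathcal{M}_1+(1-\lambda)\mathcal{M}_2$, and let $\mu=\mathrm{denom}(\lambda)$. Then $\mathcal{M}$ is $\mu$-paving.
   Context: $\mathcal{L}(E)$ is the lattice of subspaces of $E$; a $q$-polymatroid is $(\mathcal{L}(E),\rho)$ with $\rho:\mathcal{L}(E)\to\mathbb{R}$ satisfying $0\le\rho(A)\le\dim A$, monotonicity, and submodularity $\rho(A\cap B)+\rho(A+B)\le\rho(A)+\rho(B)$; a $q$-matroid if $\rho$ is integer-valued. The paving $q$-matroid induced by $\mathcal{S}$ (a collection of $k$-spaces with pairwise intersections of dimension $\le k-2$) has rank function $\rho_{\mathcal{S}}(V)=k-1$ if $V\in\mathcal{S}$ and $\rho_{\mathcal{S}}(V)=\min\{\dim V,k\}$ otherwise. For $q$-polymatroids $\mathcal{M}_1,\mathcal{M}_2$ with rank functions $\rho_1,\rho_2$ and $0<\lambda<1$, the convex combination $\lambda\mathcal{M}_1+(1-\lambda)\mathcal{M}_2$ is the $q$-polymatroid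 with rank function $\lambda\rho_1+(1-\lambda)\rho_2$. $\mathrm{denom}(\lambda)$ is the denominator $b$ of $\lambda=a/b$ in lowest terms. A denominator of a rational $q$-polymatroid is $\mu\in\mathbb{Q}_{>0}$ with $\mu\rho(X)\in\mathbb{Z}_{\ge0}$ for all $X$ ($\mathrm{denom}(\lambda)$ is one for $\mathcal{M}$). For a denominator $\mu$: a space $I$ is $\mu$-independent if $\rho(J)\ge\dim(J)/\mu$ for all $J\le I$, $\mu$-dependent otherwise; a $\mu$-circuit is a $\mu$-dependent space all of whose proper subspaces are $\mu$-independent. $\mathcal{M}$ is $\mu$-paving if every $\mu$-circuit $C$ satisfies $\dim(C)\ge\max\{\dim V: V \text{ is } \mu\text{-independent}\}$. *)

(* Defs.v *)
From HB Require Import structures.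
From mathcomp Require Import all_boot all_order all_algebra.
From mathcomp Require Import boolp classical_sets reals.
From mathcomp Require Import zify.

Set Implicit Arguments.
Unset Strict Implicit.
Unset Printing Implicit Defensive.
Import Order.TTheory GRing.Theory Num.Theory.
Local Open Scope classical_set_scope.
Local Open Scope ring_scope.

Record qpolymatroid (R : realType) (F : fieldType) (E : vectType F) :=
  QPolymatroid {
    rank :> {vspace E} -> R;
    rank_bounded : forall A, 0 <= rank A <= (\dim A)%:R;
    rank_mono : forall A B, (A <= B)%VS -> rank A <= rank B;
    rank_submod : forall A B,
      rank (A :&: B)%VS + rank (A + B)%VS <= rank A + rank B }.

Record qmatroid (R : realType) (F : fieldType) (E : vectType F) := QMatroid {
  qmatroid_poly :> qpolymatroid R E;
  qmatroid_int : forall A, qmatroid_poly A \is a Num.int }.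

Section MuNotions.
Variables (R : realType) (F : fieldType) (E : vectType F).
Variables (M : qpolymatroid R E) (mu : rat).

Definition is_denominator : Prop :=
  0 < mu /\ forall X : {vspace E}, ratr mu * M X \is a Num.nat.

Definition mu_independent (I : {vspace E}) : Prop :=
  forall J : {vspace E}, (J <= I)%VS -> M J >= (\dim J)%:R / ratr mu.

Definition mu_dependent (I : {vspace E}) : Prop := ~ mu_independent I.

Definition mu_circuit (C : {vspace E}) : Prop :=
  mu_dependent C /\
  forall J : {vspace E}, (J <= C)%VS -> J <> C -> mu_independent J.

(* The set of dimensions is bounded by dim E, so this is a genuine maximum as
   soon as some mu-independent space exists; the zero space is always one. *)
Definition max_dim_mu_independent : nat :=
  \max_(d < (\dim {:E}).+1
        | `[< exists V : {vspace E}, mu_independent V /\ \dim V = d >]) d.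

Definition mu_paving : Prop :=
  forall C : {vspace E}, mu_circuit C -> (max_dim_mu_independent <= \dim C)%N.

End MuNotions.

Lemma mu_independent0 (R : realType) (F : fieldType) (E : vectType F)
  (M : qpolymatroid R E) (mu : rat) : mu_independent M mu 0%VS.
Proof.
move=> J; rewrite subv0 => /eqP ->; rewrite dimv0 mul0r.
by case/andP: (rank_bounded M 0%VS).
Qed.

(* The bound dim (V :&: W) <= k - 2 is written without truncated subtraction;
   for k = 1 it forces S to have at most one element. *)
Definition paving_collection (F : fieldType) (E : vectType F) (k : nat)
    (S : set {vspace E}) : Prop :=
  (forall V, S V -> \dim V = k) /\
  (forall V W, S V -> S W -> V <> W -> (\dim (V :&: W)%VS + 2 <= k)%N).

Definition paving_rank (R : realType) (F : fieldType) (E : vectType F)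
    (k : nat) (S : set {vspace E}) (V : {vspace E}) : R :=
  if V \in S then k%:R - 1 else (minn (\dim V) k)%:R.

Section Paving.
Variables (R : realType) (F : fieldType) (E : vectType F) (k : nat).
Variable S : set {vspace E}.
Hypotheses (k_gt0 : (1 <= k)%N) (S_pav : paving_collection k S).

Let g (V : {vspace E}) : nat := if V \in S then k.-1 else minn (\dim V) k.

Let rankE V : paving_rank R k S V = (g V)%:R.
Proof.
rewrite /paving_rank /g; case: ifP => // _.
by rewrite -[in LHS](prednK k_gt0) -natr1 addrK.
Qed.

Let gS V : V \in S -> g V = k.-1 /\ \dim V = k.
Proof. by rewrite /g => VS; rewrite VS; split=> //; apply: S_pav.1; rewrite inE in VS. Qed.

Let gNS V : V \notin S -> g V = minn (\dim V) k.
Proof. by rewrite /g => /negbTE ->. Qed.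

Let g_le V : (g V <= minn (\dim V) k)%N.
Proof. by have [/gS[-> ->]|/gNS ->] := boolP (V \in S); lia. Qed.

Let dim_lt (A B : {vspace E}) : (A <= B)%VS -> A <> B -> (\dim A < \dim B)%N.
Proof.
move=> AB nAB; rewrite ltnNge; apply/negP => BA.
by apply: nAB; apply/eqP; rewrite eqEdim AB.
Qed.

Let g_mono A B : (A <= B)%VS -> (g A <= g B)%N.
Proof.
move=> AB; have [->//|/eqP nAB] := eqVneq A B.
have := dim_lt AB nAB; have := g_le A.
by have [/gS[-> ->]|/gNS ->] := boolP (B \in S); lia.
Qed.

Let g_submod_l A B : A \in S ->
  (g (A :&: B)%VS + g (A + B)%VS <= g A + g B)%N.
Proof.
move=> AS.
have [AB|nAB] := boolP (A <= B)%VS.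
  by rewrite (capv_idPl AB) (addv_idPr AB).
have [BA|nBA] := boolP (B <= A)%VS.
  by rewrite (capv_idPr BA) (addv_idPl BA) addnC.
have d1 : (\dim (A :&: B)%VS < \dim A)%N.
  by apply: dim_lt (capvSl _ _) _ => /capv_idPl; apply/negP.
have d2 : (\dim (A :&: B)%VS < \dim B)%N.
  by apply: dim_lt (capvSr _ _) _ => /capv_idPr; apply/negP.
have := g_le (A :&: B)%VS; have := g_le (A + B)%VS.
have [gA dA] := gS AS; rewrite gA.
have [BS|/gNS ->] := boolP (B \in S); last lia.
have [-> dB] := gS BS.
have H := S_pav.2 A B (set_mem AS) (set_mem BS).
have {}H : (\dim (A :&: B)%VS + 2 <= k)%N.
  by apply: H => eAB; move: nAB; rewrite eAB subvv.
by lia.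
Qed.

Let g_submod A B : (g (A :&: B)%VS + g (A + B)%VS <= g A + g B)%N.
Proof.
have [AS|/gNS gA] := boolP (A \in S); first exact: g_submod_l.
have [BS|/gNS gB] := boolP (B \in S).
  by rewrite capvC addvC [leqRHS]addnC; exact: g_submod_l.
have := g_le (A :&: B)%VS; have := g_le (A + B)%VS.
have := dimv_sum_cap A B; have := dimvS (capvSl A B).
have := dimvS (capvSr A B).
by rewrite gA gB; lia.
Qed.

Fact paving_bounded A : 0 <= paving_rank R k S A <= (\dim A)%:R.
Proof. by rewrite rankE ler0n ler_nat; have := g_le A; lia. Qed.

Fact paving_mono A B :
  (A <= B)%VS -> paving_rank R k S A <= paving_rank R k S B.
Proof. by move=> AB; rewrite !rankE ler_nat g_mono. Qed.

Fact paving_submod A B :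
  paving_rank R k S (A :&: B)%VS + paving_rank R k S (A + B)%VS
    <= paving_rank R k S A + paving_rank R k S B.
Proof. by rewrite !rankE -!natrD ler_nat g_submod. Qed.

Definition paving_qpolymatroid : qpolymatroid R E :=
  QPolymatroid paving_bounded paving_mono paving_submod.

Fact paving_int A : paving_qpolymatroid A \is a Num.int.
Proof. by rewrite /= rankE. Qed.

Definition paving_qmatroid : qmatroid R E := QMatroid paving_int.

End Paving.

Section Convex.
Variables (R : realType) (F : fieldType) (E : vectType F).
Variables (l : R) (M1 M2 : qpolymatroid R E).
Hypothesis l01 : 0 < l < 1.

Definition convex_rank (V : {vspace E}) : R := l * M1 V + (1 - l) * M2 V.

Let l_ge0 : 0 <= l. Proof. by case/andP: l01 => /ltW. Qed.
Let lC_ge0 : 0 <= 1 - l.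
Proof. by case/andP: l01 => _ /ltW; rewrite subr_ge0. Qed.

Fact convex_bounded A : 0 <= convex_rank A <= (\dim A)%:R.
Proof.
have /andP[a0 ad] := rank_bounded M1 A.
have /andP[b0 bd] := rank_bounded M2 A.
have := lerD (ler_wpM2l l_ge0 ad) (ler_wpM2l lC_ge0 bd).
by rewrite /convex_rank addr_ge0 ?mulr_ge0 //= -mulrDl subrKC mul1r.
Qed.

Fact convex_mono A B : (A <= B)%VS -> convex_rank A <= convex_rank B.
Proof.
by move=> AB; rewrite lerD // ler_wpM2l // rank_mono.
Qed.

Fact convex_submod A B :
  convex_rank (A :&: B)%VS + convex_rank (A + B)%VS
    <= convex_rank A + convex_rank B.
Proof.
rewrite /convex_rank addrACA -!mulrDr [leRHS]addrACA -!mulrDr.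
by rewrite lerD // ler_wpM2l // rank_submod.
Qed.

Definition convex_comb : qpolymatroid R E :=
  QPolymatroid convex_bounded convex_mono convex_submod.

End Convex.

Lemma ratr_01 (R : realType) (l : rat) : 0 < l < 1 -> 0 < (ratr l : R) < 1.
Proof.
case/andP=> l0 l1; rewrite ltr0q l0 /=.
by have := ltr_rat R l 1; rewrite rmorph1 l1 => ->.
Qed.

Lemma denq_is_denominator (R : realType) (F : fieldType) (E : vectType F)
  (l : rat) (M1 M2 : qmatroid R E) (l01 : 0 < l < 1) :
  is_denominator (convex_comb M1 M2 (ratr_01 R l01)) (denq l)%:~R.
Proof.
split=> [|X]; first by rewrite ltr0z denq_gt0.
have H0 : 0 <= convex_rank (ratr l) M1 M2 X.
  by case/andP: (rank_bounded (convex_comb M1 M2 (ratr_01 R l01)) X).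
rewrite natrEint mulr_ge0 ?ler0q ?ler0z ?denq_ge0 // andbT.
have e : (denq l)%:~R * ratr l = (numq l)%:~R :> R.
  by rewrite -ratr_int -rmorphM mulrC -numqE /= ratr_int.
rewrite ratr_int -[X in _ * X]/(ratr l * M1 X + (1 - ratr l) * M2 X).
rewrite mulrDr mulrA e mulrA mulrBr mulr1 e -intrB.
by apply: rpredD; apply: rpredM; rewrite ?intr_int //; apply: qmatroid_int.
Qed.

(* Main.v *)
Require Import Defs.
From mathcomp Require Import all_boot all_order all_algebra.
From mathcomp Require Import boolp classical_sets reals.
From mathcomp Require Import lra.

Import Order.TTheory GRing.Theory Num.Theory.
Local Open Scope classical_set_scope.
Local Open Scope ring_scope.

(** Let b = denom(lambda). A space J lying in S1 or S2 belongs to only one of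
    them, so it has dimension k and rank k - lambda or k - (1 - lambda); both
    are at least k - 1 + 1/b, hence at least k/b. Any other space has rank
    min(dim J, k). Therefore rho(J) >= dim J / b holds exactly when
    dim J <= k * b: mu-independence depends on the dimension only, and then
    every mu-dependent space is larger than every mu-independent one. *)

(** A space of dimension at most [N] has only subspaces of dimension at most [N], so it is
    independent; hence a circuit exceeds [N]. Taking [J := V] bounds an independent [V] by [N]. *)
Lemma mu_paving_of_dim_bound (R : realType) (F : fieldType) (E : vectType F)
    (M : qpolymatroid R E) (mu : rat) (N : nat) :
  (forall J, ((\dim J)%:R / ratr mu <= M J) = (\dim J <= N)%N) ->
  mu_paving M mu.
Proof.
move=> H C [Cdep _].
have NC : (N < \dim C)%N.
  rewrite ltnNge; apply/negP => CN; apply: Cdep => J JC.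
  by rewrite H (leq_trans (dimvS JC)).
apply/bigmax_leqP => d /asboolP[V [Vind <-]].
by apply: leq_trans (ltnW NC); rewrite -H; apply: Vind.
Qed.

Lemma paving_rank_le (R : realType) (F : fieldType) (E : vectType F) (k : nat)
    (S : set {vspace E}) (V : {vspace E}) : paving_rank R k S V <= k%:R.
Proof.
rewrite /paving_rank; case: ifP => _; first by rewrite lerBlDr lerDl.
by rewrite ler_nat geq_minr.
Qed.

(** The numerator of [l] is a positive integer, hence at least 1. *)
Lemma inv_denq_le (l : rat) : 0 < l -> (denq l)%:~R^-1 <= l.
Proof.
move=> l0; rewrite -[leRHS]divq_num_den ler_peMl ?invr_ge0 ?ler0z ?denq_ge0 //.
by rewrite -[leLHS]/(1%:~R) ler_int -gtz0_ge1 numq_gt0.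
Qed.

(** Over the denominator [denq l], the numerator of [1 - l] is the positive integer
    [denq l - numq l]. *)
Lemma inv_denq_le_onem (l : rat) : l < 1 -> (denq l)%:~R^-1 <= 1 - l.
Proof.
move=> l1; have d0 : 0 < (denq l)%:~R :> rat by rewrite ltr0z denq_gt0.
rewrite -(ler_pM2r d0) mulVf ?gt_eqF // mulrBl mul1r -numqE -intrB.
rewrite -[leLHS]/(1%:~R) ler_int -gtz0_ge1 subr_gt0 -(ltr_int rat) numqE.
by rewrite gtr_pMl.
Qed.

(** Here [c] stands for 1/b, which is at most both weights [l] and [1 - l]. *)
Lemma convex_paving_rank_ge (R : realType) (F : fieldType) (E : vectType F)
    (k : nat) (S1 S2 : set {vspace E}) (l c : R) (J : {vspace E}) :
  (1 <= k)%N -> (forall V, S1 V -> \dim V = k) ->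
  (forall V, S2 V -> \dim V = k) -> S1 `&` S2 = set0 ->
  0 <= c -> c <= l -> c <= 1 - l -> (\dim J)%:R * c <= k%:R ->
  (\dim J)%:R * c <= l * paving_rank R k S1 J + (1 - l) * paving_rank R k S2 J.
Proof.
move=> k1 dS1 dS2 S12 c0 cl cl' Jk.
have k1R : 1 <= k%:R :> R by rewrite ler1n.
rewrite /paving_rank.
case: ifP => [/set_mem J1|_]; case: ifP => [/set_mem J2|J2].
- by have : (S1 `&` S2) J by []; rewrite S12.
(* The rank is [k - l], and [k * c <= k * (1 - l) <= k - l] since [1 <= k]; the next case swaps [l]
   and [1 - l]. *)
- by rewrite (dS1 J J1) minnn; nra.
- by rewrite (dS2 J J2) minnn; nra.
(* Above dimension [k] the goal is the hypothesis on [J]; otherwise it follows from [c <= 1], as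
   [c <= l] and [c <= 1 - l]. *)
rewrite -mulrDl subrKC mul1r; case: leqP => // _.
by rewrite ler_piMr //; lra.
Qed.

Theorem theorem5p5 (R : realType) (F : finFieldType) (n k : nat)
    (S1 S2 : set {vspace 'rV[F]_n}) (lambda : rat)
    (n_ge2 : (2 <= n)%N) (k_ge1 : (1 <= k)%N) (k_le : (k <= n - 1)%N)
    (S1_pav : paving_collection k S1) (S2_pav : paving_collection k S2)
    (S12 : S1 `&` S2 = set0) (lambda01 : 0 < lambda < 1) :
  let M1 := paving_qmatroid R k_ge1 S1_pav in
  let M2 := paving_qmatroid R k_ge1 S2_pav in
  let M := convex_comb M1 M2 (ratr_01 R lambda01) in
  let mu : rat := (denq lambda)%:~R in
  mu_paving M mu.
Proof.
move=> M1 M2 M mu.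
have /andP[l0 l1] := lambda01.
have /andP[l0R l1R] := ratr_01 R lambda01.
have mu0 : 0 < ratr mu :> R by rewrite ltr0q ltr0z denq_gt0.
apply: (@mu_paving_of_dim_bound _ _ _ _ _ (k * `|denq lambda|)%N) => J.
have -> : (\dim J <= k * `|denq lambda|)%N = ((\dim J)%:R / ratr mu <= k%:R :> R).
  rewrite ler_pdivrMr // -(ler_nat R) natrM ratr_int.
  by rewrite -[in RHS](gtz0_abs (denq_gt0 lambda)) -pmulrn.
rewrite -[M J]/(ratr lambda * paving_rank R k S1 J
  + (1 - ratr lambda) * paving_rank R k S2 J).
apply/idP/idP => [/le_trans -> // | Jk].
  (* Both ranks are at most [k], hence so is their convex combination. *)
  have := paving_rank_le R _ _ k S1 J; have := paving_rank_le R _ _ k S2 J.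
  by nra.
apply: convex_paving_rank_ge S12 _ _ _ Jk => //.
- exact: S1_pav.1.
- exact: S2_pav.1.
- by rewrite invr_ge0 ltW.
- by rewrite -fmorphV ler_rat inv_denq_le.
- by rewrite -fmorphV -(rmorph1 (ratr : rat -> R)) -rmorphB ler_rat inv_denq_le_onem.
Qed.
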